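(* Let $N\geq 2$, let $\mathcal{P},\mathcal{M}$ be nonempty disjoint sets with $\mathcal{P}\cup\mathcal{M}=\{1,\dots,N\}$, and let $A\in\mathbb{R}^{n\times n}$, $B\in\mathbb{R}^{n\times m}$, $C_i\in\mathbb{R}^{p_i\times n}$, $D_i\in\mathbb{R}^{p_i\times m}$ for $i\in\{1,\dots,N\}$, where all eigenvalues of $A$ have negative real part and $(A,B)$ is controllable. Consider $$\dot x(t)=Ax(t)+Bu(t),\quad x(0)=0,\quad y_i(t)=C_ix(t)+D_iu(t),\quad i\in\{1,\dots,N\}.$$ Let $Q_i=Q_i^\top\succeq0$ ($i\in\mathcal{P}$), $R_j=R_j^\top\succeq0$ and $\delta_j>0$ ($j\in\mathcal{M}$). Consider $$(\mathrm{OP})\qquad\sup_{u\in\mathcal{L}_{2e}}\ \frac1{|\mathcal{P}|}\sum_{i\in\mathcal{P}}\int_0^\infty y_i(t)^\top Q_iy_i(t)\,dt\quad\text{s.t.}\quad\int_0^\infty y_j(t)^\top R_jy_j(t)\,dt\le\delta_j\quad\forall j\in\mathcal{M},$$ and the semidefinite program $$(\mathrm{SDP})\qquad\min_{\bm{\gamma}\ge0,\,P}\ \sum_{j\in\mathcal{M}}\gamma_j\delta_j\quad\text{s.t.}\quad\begin{bmatrix}A^\top P+PA & PB \\ B^\top P & 0\end{bmatrix}+\Gamma\preceq0,\quad P=P^\top\succeq0,$$ where $\bm{\gamma}\in\mathbb{R}^{|\mathcal{M}|}$ is the stacked vector of the $\gamma_j$, $j\in\mathcal{M}$, $\bm\gamma\ge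 0$ is elementwise, $P\in\mathbb{R}^{n\times n}$, and $$\Gamma=\frac1{|\mathcal{P}|}\sum_{i\in\mathcal{P}}\begin{bmatrix}C_i^\top \\ D_i^\top\end{bmatrix}Q_i\begin{bmatrix}C_i & D_i\end{bmatrix}-\sum_{j\in\mathcal{M}}\gamma_j\begin{bmatrix}C_j^\top \\ D_j^\top\end{bmatrix}R_j\begin{bmatrix}C_j & D_j\end{bmatrix}.$$ Let $\Sigma_p$ and $\Sigma_m$ denote the state-space systems with state equation $\dot x(t)=Ax(t)+Bu(t)$, $x(0)=0$, input $u$, and output vectors $$y_p=\frac1{\sqrt{|\mathcal{P}|}}\operatorname{col}_{i\in\mathcal{P}}\big(\sqrt{Q_i}\,y_i\big),\qquad y_m=\operatorname{col}_{j\in\mathcal{M}}\big(\sqrt{R_j}\,y_j\big),$$ respectively. Then: (a) The value of $(\mathrm{OP})$ is upper bounded by the value of $(\mathrm{SDP})$. (b) If $\Sigma_m$ has an unstable finite zero that is not a zero of $\Sigma_p$, then the value of $(\mathrm{SDP})$ is unbounded (equal to $+\infty$).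
   Context: $\mathcal{L}_{2e}$ is the set of signals $u:\mathbb{R}_+\to\mathbb{R}^m$ with $\int_0^{T}u(t)^\top u(t)\,dt<\infty$ for every $T\in\mathbb{R}_+$. $\operatorname{col}$ denotes vertical stacking and $\sqrt{Q}$ the symmetric positive semidefinite square root. Finite zeros: $\beta\in\mathbb{C}$ is a (finite, invariant) zero of $\Sigma=(A,B,C,D)$ if there exist $x_0$ (of dimension $n$) and $g$ (of dimension $m$), complex-valued in general and not both zero, such that $\begin{bmatrix}\beta I-A & B \\ C & -D\end{bmatrix}\begin{bmatrix}x_0 \\ g\end{bmatrix}=\begin{bmatrix}0 \\ 0\end{bmatrix}$. The zero is unstable if $\Re(\beta)>0$. Conventions: the value of a minimization problem with empty feasible set is $+\infty$ (this is what ''unbounded'' means for a minimization problem here); integrals of nonnegative functions may take the value $+\infty$. *)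

(* Defs.v *)
From mathcomp Require Import all_boot all_order all_algebra.
From mathcomp Require Import complex.
From mathcomp Require Import all_classical all_reals all_analysis.

Set Implicit Arguments.
Unset Strict Implicit.
Unset Printing Implicit Defensive.

Import Order.TTheory GRing.Theory Num.Theory.
Import numFieldNormedType.Exports.

Local Open Scope classical_set_scope.
Local Open Scope complex_scope.
Local Open Scope ring_scope.

Definition qform (R : realType) (k : nat) (Q : 'M[R]_k) (v : 'cV[R]_k) : R :=
  (v^T *m Q *m v) 0 0.

Definition psdmx (R : realType) (k : nat) (Q : 'M[R]_k) : Prop :=
  Q^T = Q /\ forall v : 'cV[R]_k, 0 <= qform Q v.

Definition nsdmx (R : realType) (k : nat) (Q : 'M[R]_k) : Prop := psdmx (- Q).

(* The default value 0 is only returned when [Q] has no symmetric positive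
   semidefinite square root, that is, when [Q] itself is not symmetric
   positive semidefinite. *)
Definition sqrtmx (R : realType) (k : nat) (Q : 'M[R]_k) : 'M[R]_k :=
  xget 0 [set S : 'M[R]_k | psdmx S /\ S *m S = Q].

(* Signals on the half-line are functions on [R] of which only the values on
   [0, +oo[ are ever used. *)
Definition L2e (R : realType) (m : nat) (u : R -> 'cV[R]_m) : Prop :=
  (forall i, measurable_fun (`[0, +oo[ : set R) (fun t : R => u t i 0 : R)) /\
  (forall T : R, 0 <= T ->
     (\int[lebesgue_measure]_(t in `[0%R, T]) (((u t)^T *m u t) 0 0)%:E
        < +oo)%E).

(* Caratheodory solutions of x' = A x + B u, x(0) = x0: inputs in L2e need not
   be continuous, so the differential equation is read in integrated form.
   For u in L2e and x continuous the integrand is integrable on [0, t], and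
   the solution exists and is unique on [0, +oo[. *)
Definition trajectory (R : realType) (n m : nat) (A : 'M[R]_n)
    (B : 'M[R]_(n, m)) (x0 : 'cV[R]_n) (u : R -> 'cV[R]_m)
    (x : R -> 'cV[R]_n) : Prop :=
  (forall i, {within `[0, +oo[, continuous (fun t : R => x t i 0 : R)}) /\
  (forall (t : R) i, 0 <= t ->
     x t i 0 = x0 i 0 +
       \int[lebesgue_measure]_(s in `[0, t]) (A *m x s + B *m u s) i 0).

Definition controllable (R : realType) (n m : nat) (A : 'M[R]_n)
    (B : 'M[R]_(n, m)) : Prop :=
  forall x0 x1 : 'cV[R]_n, exists (T : R) u x,
    [/\ 0 <= T, L2e u, trajectory A B x0 u x & x T = x1].

Definition hurwitz (R : realType) (n : nat) (A : 'M[R]_n) : Prop :=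
  forall l : R[i], eigenvalue (map_mx (real_complex R) A) l ->
    complex.Re l < 0.

Record ssys (R : realType) (n m q : nat) := SSys {
  ssA : 'M[R]_n;
  ssB : 'M[R]_(n, m);
  ssC : 'M[R]_(q, n);
  ssD : 'M[R]_(q, m) }.

Definition is_zero (R : realType) (n m q : nat) (S : ssys R n m q)
    (b : R[i]) : Prop :=
  let toC k l (X : 'M[R]_(k, l)) := map_mx (real_complex R) X in
  exists (x0 : 'cV[R[i]]_n) (g : 'cV[R[i]]_m),
    ~ (x0 = 0 /\ g = 0) /\
    block_mx (b%:M - toC _ _ (ssA S)) (toC _ _ (ssB S))
             (toC _ _ (ssC S)) (- toC _ _ (ssD S)) *m col_mx x0 g = 0.

Definition unstable (R : realType) (b : R[i]) : Prop := 0 < complex.Re b.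

(* [enum_val : 'I_#|S| -> 'I_N] enumerates the members of S, so the output of
   this system is col_{i in S} (sqrt(W_i) y_i), scaled by c. *)
Definition stacked_sys (R : realType) (N n m : nat) (p : 'I_N -> nat)
    (A : 'M[R]_n) (B : 'M[R]_(n, m))
    (C : forall i, 'M[R]_(p i, n)) (D : forall i, 'M[R]_(p i, m))
    (S : {set 'I_N}) (W : forall i, 'M[R]_(p i)) (c : R) :
    ssys R n m (\sum_(k < #|S|) p (enum_val k)) :=
  SSys A B
    (c *: \mxcol_(k < #|S|) (sqrtmx (W (enum_val k)) *m C (enum_val k)))
    (c *: \mxcol_(k < #|S|) (sqrtmx (W (enum_val k)) *m D (enum_val k))).

Definition Sigma_p (R : realType) (N n m : nat) (p : 'I_N -> nat)
    (A : 'M[R]_n) (B : 'M[R]_(n, m))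
    (C : forall i, 'M[R]_(p i, n)) (D : forall i, 'M[R]_(p i, m))
    (Pset : {set 'I_N}) (Q : forall i, 'M[R]_(p i)) :=
  stacked_sys A B C D Pset Q (Num.sqrt #|Pset|%:R)^-1.

Definition Sigma_m (R : realType) (N n m : nat) (p : 'I_N -> nat)
    (A : 'M[R]_n) (B : 'M[R]_(n, m))
    (C : forall i, 'M[R]_(p i, n)) (D : forall i, 'M[R]_(p i, m))
    (Mset : {set 'I_N}) (Rw : forall i, 'M[R]_(p i)) :=
  stacked_sys A B C D Mset Rw 1.

Definition energy (R : realType) (k : nat) (W : 'M[R]_k)
    (y : R -> 'cV[R]_k) : \bar R :=
  (\int[lebesgue_measure]_(t in `[0%R, +oo[) (qform W (y t))%:E)%E.

Definition output (R : realType) (n m q : nat) (C : 'M[R]_(q, n))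
    (D : 'M[R]_(q, m)) (u : R -> 'cV[R]_m) (x : R -> 'cV[R]_n) (t : R) :
    'cV[R]_q :=
  C *m x t + D *m u t.

(* Supremum over the inputs; x is the state trajectory from the origin that the
   input u determines. The weights R_j are called [Rw j], [R] being the reals. *)
Definition OP_value (R : realType) (N n m : nat) (p : 'I_N -> nat)
    (A : 'M[R]_n) (B : 'M[R]_(n, m))
    (C : forall i, 'M[R]_(p i, n)) (D : forall i, 'M[R]_(p i, m))
    (Pset Mset : {set 'I_N}) (Q Rw : forall i, 'M[R]_(p i))
    (delta : 'I_N -> R) : \bar R :=
  ereal_sup [set J : \bar R | exists u x,
    [/\ L2e u,
        trajectory A B 0 u x,
        (forall j, j \in Mset ->
           (energy (Rw j) (output (C j) (D j) u x) <= (delta j)%:E)%E) &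
        J = ((#|Pset|%:R^-1)%:E *
             \sum_(i in Pset) energy (Q i) (output (C i) (D i) u x))%E]].

(* The k-th entry of [gam] is the multiplier of the k-th member of Mset. *)
Definition Gamma (R : realType) (N n m : nat) (p : 'I_N -> nat)
    (C : forall i, 'M[R]_(p i, n)) (D : forall i, 'M[R]_(p i, m))
    (Pset Mset : {set 'I_N}) (Q Rw : forall i, 'M[R]_(p i))
    (gam : 'cV[R]_#|Mset|) : 'M[R]_(n + m) :=
  #|Pset|%:R^-1 *: (\sum_(i in Pset)
    col_mx (C i)^T (D i)^T *m Q i *m row_mx (C i) (D i))
  - \sum_(k < #|Mset|) gam k 0 *:
      (let j := enum_val k in
       col_mx (C j)^T (D j)^T *m Rw j *m row_mx (C j) (D j)).

Definition SDP_feasible (R : realType) (N n m : nat) (p : 'I_N -> nat)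
    (A : 'M[R]_n) (B : 'M[R]_(n, m))
    (C : forall i, 'M[R]_(p i, n)) (D : forall i, 'M[R]_(p i, m))
    (Pset Mset : {set 'I_N}) (Q Rw : forall i, 'M[R]_(p i))
    (gam : 'cV[R]_#|Mset|) (P : 'M[R]_n) : Prop :=
  [/\ forall k, 0 <= gam k 0,
      psdmx P &
      nsdmx (block_mx (A^T *m P + P *m A) (P *m B) (B^T *m P) 0
             + Gamma C D Pset Q Rw gam)].

(* [ereal_inf] of the empty set is [+oo]. *)
Definition SDP_value (R : realType) (N n m : nat) (p : 'I_N -> nat)
    (A : 'M[R]_n) (B : 'M[R]_(n, m))
    (C : forall i, 'M[R]_(p i, n)) (D : forall i, 'M[R]_(p i, m))
    (Pset Mset : {set 'I_N}) (Q Rw : forall i, 'M[R]_(p i))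
    (delta : 'I_N -> R) : \bar R :=
  ereal_inf [set v : \bar R | exists (gam : 'cV[R]_#|Mset|) (P : 'M[R]_n),
    SDP_feasible A B C D Pset Q Rw gam P /\
    v = (\sum_(k < #|Mset|) gam k 0 * delta (enum_val k))%:E].

(* Main.v *)
(* A feasible (gamma, P) makes V(x) = x^T P x a storage function: testing the
   matrix inequality on (x, u) gives
     dV/dt + |P|^-1 sum_i y_i^T Q_i y_i <= sum_j gamma_j y_j^T R_j y_j.
   Integrating from x(0) = 0 and dropping V(x(T)) >= 0 bounds the objective of
   (OP) by sum_j gamma_j delta_j. Since u is only locally square integrable, the
   integral of dV/dt is computed by Fubini's theorem.
   For (b), test the same inequality on the real and imaginary parts of a
   vector realizing the zero b of Sigma_m: the right-hand sides vanish and the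
   derivative terms add up to a nonnegative multiple of Re b, so the outputs of
   Sigma_p vanish too, making b a zero of Sigma_p. *)

Require Import Defs.
From mathcomp Require Import all_boot all_order all_algebra.
From mathcomp Require Import complex.
From mathcomp Require Import all_classical all_reals all_analysis.
From mathcomp Require Import sesquilinear spectral measurable_realfun ring lra.

Set Implicit Arguments.
Unset Strict Implicit.
Unset Printing Implicit Defensive.

Import Order.TTheory GRing.Theory Num.Theory.
Import numFieldNormedType.Exports.

Local Open Scope complex_scope.
Local Open Scope ring_scope.

(** * Polynomial interpolation, and real and imaginary parts of complex matrices *)

Lemma poly_interpolation (F : fieldType) (s : seq F) (f : F -> F) :
  exists p : {poly F}, {in s, forall x, p.[x] = f x}.
Proof.
elim: s => [|a s [p pE]]; first by exists 0.
have [as_|as_] := boolP (a \in s).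
  by exists p => x; rewrite inE => /predU1P[->|/pE//]; exact: pE.
(* Newton's step: [w] vanishes at all earlier nodes and not at the new node [a], so adding a
   multiple of it corrects the value at [a] and leaves the others unchanged. *)
pose w := \prod_(b <- s) ('X - b%:P).
have wa : w.[a] != 0 by rewrite -rootE root_prod_XsubC.
exists (p + ((f a - p.[a]) / w.[a]) *: w) => x.
rewrite inE hornerD hornerZ => /predU1P[->|xs].
  by rewrite divfK// subrKC.
have -> : w.[x] = 0 by apply/eqP; rewrite -rootE root_prod_XsubC.
by rewrite mulr0 addr0 pE.
Qed.

Lemma Re_map_mulmx (R : realType) k l q (X : 'M[R]_(k, l)) (z : 'M[R[i]]_(l, q)) :
  map_mx (@complex.Re R) (map_mx (real_complex R) X *m z) =
  X *m map_mx (@complex.Re R) z.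
Proof.
apply/matrixP => i j; rewrite !mxE.
rewrite (big_morph (@complex.Re R) (id1 := 0) (op1 := +%R)); last 2 first.
- by move=> [a b] [c d].
- by [].
by apply: eq_bigr => s _; rewrite !mxE; case: (z s j) => a b /=; rewrite mul0r subr0.
Qed.

Lemma Im_map_mulmx (R : realType) k l q (X : 'M[R]_(k, l)) (z : 'M[R[i]]_(l, q)) :
  map_mx (@complex.Im R) (map_mx (real_complex R) X *m z) =
  X *m map_mx (@complex.Im R) z.
Proof.
apply/matrixP => i j; rewrite !mxE.
rewrite (big_morph (@complex.Im R) (id1 := 0) (op1 := +%R)); last 2 first.
- by move=> [a b] [c d].
- by [].
by apply: eq_bigr => s _; rewrite !mxE; case: (z s j) => a b /=; rewrite mul0r addr0.
Qed.

Lemma Re_mxD (R : realType) k l (z w : 'M[R[i]]_(k, l)) :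
  map_mx (@complex.Re R) (z + w) =
  map_mx (@complex.Re R) z + map_mx (@complex.Re R) w.
Proof. by apply/matrixP => i j; rewrite !mxE; case: (z i j) (w i j) => ? ? []. Qed.

Lemma Im_mxD (R : realType) k l (z w : 'M[R[i]]_(k, l)) :
  map_mx (@complex.Im R) (z + w) =
  map_mx (@complex.Im R) z + map_mx (@complex.Im R) w.
Proof. by apply/matrixP => i j; rewrite !mxE; case: (z i j) (w i j) => ? ? []. Qed.

Lemma Re_scalemx (R : realType) k l (b : R[i]) (z : 'M[R[i]]_(k, l)) :
  map_mx (@complex.Re R) (b *: z) = complex.Re b *: map_mx (@complex.Re R) z -
    complex.Im b *: map_mx (@complex.Im R) z.
Proof. by apply/matrixP => i j; rewrite !mxE; case: b (z i j) => ? ? []. Qed.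

Lemma Im_scalemx (R : realType) k l (b : R[i]) (z : 'M[R[i]]_(k, l)) :
  map_mx (@complex.Im R) (b *: z) = complex.Re b *: map_mx (@complex.Im R) z +
    complex.Im b *: map_mx (@complex.Re R) z.
Proof. by apply/matrixP => i j; rewrite !mxE; case: b (z i j) => ? ? []. Qed.

Lemma ReIm_mx_inj (R : realType) k l (z w : 'M[R[i]]_(k, l)) :
  map_mx (@complex.Re R) z = map_mx (@complex.Re R) w ->
  map_mx (@complex.Im R) z = map_mx (@complex.Im R) w -> z = w.
Proof.
move=> /matrixP hr /matrixP hi; apply/matrixP => i j.
move: (hr i j) (hi i j); rewrite !mxE.
by case: (z i j) (w i j) => a b [c d] /= -> ->.
Qed.

(** * Spectrum and square root of a positive semidefinite matrix *)

Lemma sqnormE (R : realType) k (v : 'cV[R]_k) :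
  (v^T *m v) 0 0 = \sum_i v i 0 ^+ 2.
Proof. by rewrite mxE; apply: eq_bigr => i _; rewrite mxE expr2. Qed.

Lemma sqnorm_ge0 (R : realType) k (v : 'cV[R]_k) : 0 <= (v^T *m v) 0 0.
Proof. by rewrite sqnormE sumr_ge0// => i _; exact: sqr_ge0. Qed.

Lemma sqnorm_eq0 (R : realType) k (v : 'cV[R]_k) :
  (v^T *m v) 0 0 = 0 -> v = 0.
Proof.
rewrite sqnormE => /eqP; rewrite psumr_eq0; last by move=> i _; exact: sqr_ge0.
move=> /allP h; apply/colP => i; rewrite mxE; apply/eqP.
by rewrite -sqrf_eq0; apply: h; rewrite mem_index_enum.
Qed.

Lemma psdmx_eigen_ge0 (R : realType) k (Q : 'M[R]_k) (v : 'cV[R]_k) r :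
  psdmx Q -> v != 0 -> Q *m v = r *: v -> 0 <= r.
Proof.
move=> [_ Qpos] v0 Qv; have := Qpos v.
rewrite /qform -mulmxA Qv -scalemxAr mxE pmulr_lge0// lt_def sqnorm_ge0 andbT.
by apply: contra v0 => /eqP/sqnorm_eq0 ->.
Qed.

(** Over the complex numbers a real symmetric matrix is Hermitian, hence diagonalizable with real
    eigenvalues; [s] lists them. A polynomial in [Q] acts on the diagonal entrywise, so one that
    vanishes on [s] kills the matrix. *)
Lemma psdmx_annihilating_poly (R : realType) k (Q : 'M[R]_k.+1) : psdmx Q ->
  exists2 s : seq R, {in s, forall x, 0 <= x} &
    forall q : {poly R}, {in s, forall x, q.[x] = 0} -> horner_mx Q q = 0.
Proof.
move=> Qpsd; pose QC := map_mx (real_complex R) Q.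
have QCherm : QC \is hermsymmx.
  apply: realsym_hermsym.
    apply/is_hermitianmxP; rewrite expr0 scale1r map_mx_id//.
    by apply/matrixP => i j; rewrite !mxE -{1}(proj1 Qpsd) mxE.
  by apply/mxOverP => i j; rewrite mxE; apply/complex_realP; exists (Q i j).
have /mxOverP dreal := hermitian_spectral_diag_real QCherm.
have /hermitian_normalmx/orthomx_spectralP := QCherm.
set P := spectralmx QC; set d := spectral_diag QC => QCE.
have Pu : P \in unitmx := spectral_unit QC.
pose r i := complex.Re (d 0 i).
have rE i : (r i)%:C = d 0 i by apply: RRe_real; exact: dreal.
exists [seq r i | i : 'I_k.+1].
  move=> _ /mapP[i _ ->].
  (* Column [i] of [invmx P], an eigenvector of [QC] for the eigenvalue [r i]. *)
  pose w := invmx P *m (delta_mx i 0 : 'cV_k.+1).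
  have QCw : QC *m w = (r i)%:C *: w.
    rewrite {1}QCE /w -!mulmxA mulKVmx// scalemxAr; congr (_ *m _).
    apply/colP => j; rewrite mul_diag_mx !mxE rE.
    by case: eqVneq => [->|]; rewrite ?mulr0.
  have w0 : w != 0.
    apply/eqP => w0; have : P *m w = 0 by rewrite w0 mulmx0.
    rewrite /w mulKVmx// => /colP/(_ i)/eqP.
    by rewrite !mxE !eqxx oner_eq0.
  have hr := congr1 (map_mx (@complex.Re R)) QCw.
  have hi := congr1 (map_mx (@complex.Im R)) QCw.
  rewrite Re_map_mulmx Re_scalemx scale0r subr0 in hr.
  rewrite Im_map_mulmx Im_scalemx scale0r addr0 in hi.
  (* As [r i] is real, the real and imaginary parts of [w] each satisfy the eigenvalue equation for
     [Q]. At least one of them is nonzero and is a real eigenvector, which gives the sign of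
     [r i]. *)
  have [w1|w1] := eqVneq (map_mx (@complex.Re R) w) 0; last first.
    by apply: (psdmx_eigen_ge0 Qpsd w1); rewrite hr.
  have [w2|w2] := eqVneq (map_mx (@complex.Im R) w) 0; last first.
    by apply: (psdmx_eigen_ge0 Qpsd w2); rewrite hi.
  exfalso; move/eqP: w0; apply; apply: ReIm_mx_inj.
    by rewrite w1; apply/matrixP => a b; rewrite !mxE.
  by rewrite w2; apply/matrixP => a b; rewrite !mxE.
move=> q q0; apply: (map_mx_inj (f := real_complex R)); rewrite map_mx0.
rewrite map_horner_mx -/QC [QC in LHS]QCE (horner_mx_uconjC _ _ Pu) horner_mx_diag.
suff -> : map_mx (horner (map_poly (real_complex R) q)) d = 0.
  have -> : diag_mx 0 = 0 :> 'M[R[i]]_k.+1.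
    by apply/matrixP => i j; rewrite !mxE mul0rn.
  by rewrite mulmx0 mul0mx.
apply/rowP => i; rewrite !mxE -rE horner_map q0 ?rmorph0//.
by apply: map_f; rewrite mem_enum.
Qed.

Lemma trmx_horner_mx (R : comNzRingType) k (Q : 'M[R]_k.+1) (q : {poly R}) :
  (horner_mx Q q)^T = horner_mx Q^T q.
Proof.
elim/poly_ind: q => [|q c ih]; first by rewrite !rmorph0 trmx0.
rewrite !rmorphD !rmorphM /= !horner_mx_X !horner_mx_C linearD /= tr_scalar_mx.
rewrite trmx_mul ih; congr (_ + _); exact: comm_mx_horner (erefl _).
Qed.

(* Evaluating at [Q] polynomials that interpolate the square and the fourth
   root on the spectrum gives commuting symmetric [S] and [T] with [T ^ 2 = S],
   so that [S] is positive semidefinite. *)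
Lemma psdmx_sqrt_exists (R : realType) k (Q : 'M[R]_k) : psdmx Q ->
  exists S, psdmx S /\ S *m S = Q.
Proof.
case: k Q => [|k] Q Qpsd.
  by exists Q; split => //; rewrite !flatmx0.
have [s s0 sQ] := psdmx_annihilating_poly Qpsd.
have [p pE] := poly_interpolation s Num.sqrt.
have [t tE] := poly_interpolation s (Num.sqrt \o Num.sqrt).
have symQ q : (horner_mx Q q)^T = horner_mx Q q.
  by rewrite trmx_horner_mx (proj1 Qpsd).
have pp : horner_mx Q p *m horner_mx Q p = Q.
  have : horner_mx Q (p * p - 'X) = 0.
    by apply: sQ => x xs; rewrite !hornerE pE// -expr2 sqr_sqrtr ?subrr// s0.
  by rewrite rmorphB rmorphM /= horner_mx_X => /eqP; rewrite subr_eq0 => /eqP.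
have tt : horner_mx Q t *m horner_mx Q t = horner_mx Q p.
  have : horner_mx Q (t * t - p) = 0.
    apply: sQ => x xs; rewrite !hornerE pE// tE//= -expr2.
    by rewrite sqr_sqrtr ?subrr// sqrtr_ge0.
  by rewrite rmorphB rmorphM /= => /eqP; rewrite subr_eq0 => /eqP.
exists (horner_mx Q p); split => //; split => // v.
rewrite /qform -tt mulmxA -mulmxA -{1}symQ -trmx_mul.
exact: sqnorm_ge0.
Qed.

Lemma sqrtmxP (R : realType) k (Q : 'M[R]_k) : psdmx Q ->
  psdmx (sqrtmx Q) /\ sqrtmx Q *m sqrtmx Q = Q.
Proof.
move=> /psdmx_sqrt_exists[S SP]; rewrite /sqrtmx.
by case: xgetP => [//|/(_ S)].
Qed.

Lemma qform_sqrtmx (R : realType) k (Q : 'M[R]_k) (v : 'cV[R]_k) : psdmx Q ->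
  qform Q v = ((sqrtmx Q *m v)^T *m (sqrtmx Q *m v)) 0 0.
Proof.
move=> /sqrtmxP[[Ssym _] SS].
by rewrite trmx_mul Ssym mulmxA -(mulmxA v^T) SS.
Qed.

(** * Zeros in real coordinates, and vanishing outputs of the stacked systems *)

(** Write the zero direction as [x + i y] for the state and [v + i w] for [- g]. The change of sign
    of [g] absorbs the signs of [B] and [- D] in the pencil, so the two block rows read as state and
    output equations with input [- g]; splitting them into real and imaginary parts gives
    inequalities on real vectors something to act on. *)
Lemma is_zeroP (R : realType) n m q (S : ssys R n m q) (b : R[i]) :
  is_zero S b <-> exists (x y : 'cV[R]_n) (v w : 'cV[R]_m),
    [/\ ~ [/\ x = 0, y = 0, v = 0 & w = 0],
        ssA S *m x + ssB S *m v = complex.Re b *: x - complex.Im b *: y,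
        ssA S *m y + ssB S *m w = complex.Re b *: y + complex.Im b *: x,
        ssC S *m x + ssD S *m v = 0 &
        ssC S *m y + ssD S *m w = 0].
Proof.
have eqE (z : 'cV[R[i]]_n) (g : 'cV[R[i]]_m) :
    block_mx (b%:M - map_mx (real_complex R) (ssA S))
             (map_mx (real_complex R) (ssB S))
             (map_mx (real_complex R) (ssC S))
             (- map_mx (real_complex R) (ssD S)) *m col_mx z g = 0 <->
    map_mx (real_complex R) (ssA S) *m z + map_mx (real_complex R) (ssB S) *m (- g)
      = b *: z /\
    map_mx (real_complex R) (ssC S) *m z + map_mx (real_complex R) (ssD S) *m (- g)
      = 0.
  rewrite mul_block_col mulmxBl mul_scalar_mx mulNmx !mulmxN.
  split=> [/eqP|[hx ->]].
    rewrite col_mx_eq0 => /andP[/eqP h1 /eqP h2]; split => //.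
    by apply/eqP; rewrite eq_sym -subr_eq0 opprD opprK addrA h1.
  by rewrite -hx [X in col_mx (X + _)]addrAC subrr sub0r addNr col_mx0.
split=> [[z [g [zg /eqE[hx hy]]]]|[x [y [v [w [nz hx hy hx' hy']]]]]].
  exists (map_mx (@complex.Re R) z), (map_mx (@complex.Im R) z).
  exists (map_mx (@complex.Re R) (- g)), (map_mx (@complex.Im R) (- g)).
  split.
  - move=> [z1 z2 g1 g2]; apply: zg; split.
      by apply: ReIm_mx_inj; rewrite ?z1 ?z2; apply/matrixP => i j; rewrite !mxE.
    apply/eqP; rewrite -oppr_eq0; apply/eqP.
    by apply: ReIm_mx_inj; rewrite ?g1 ?g2; apply/matrixP => i j; rewrite !mxE.
  - by rewrite -!Re_map_mulmx -Re_mxD hx Re_scalemx.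
  - by rewrite -!Im_map_mulmx -Im_mxD hx Im_scalemx.
  - by rewrite -!Re_map_mulmx -Re_mxD hy; apply/matrixP => i j; rewrite !mxE.
  - by rewrite -!Im_map_mulmx -Im_mxD hy; apply/matrixP => i j; rewrite !mxE.
pose z := \matrix_(i, j) (x i j +i* y i j); pose g := \matrix_(i, j) (v i j +i* w i j).
have zr : map_mx (@complex.Re R) z = x by apply/matrixP => i j; rewrite !mxE.
have zi : map_mx (@complex.Im R) z = y by apply/matrixP => i j; rewrite !mxE.
have gr : map_mx (@complex.Re R) g = v by apply/matrixP => i j; rewrite !mxE.
have gi : map_mx (@complex.Im R) g = w by apply/matrixP => i j; rewrite !mxE.
have r0 k : map_mx (@complex.Re R) 0 = 0 :> 'cV_k by apply/matrixP => i j; rewrite !mxE.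
have i0 k : map_mx (@complex.Im R) 0 = 0 :> 'cV_k by apply/matrixP => i j; rewrite !mxE.
exists z, (- g); split.
  move=> [z0 /eqP]; rewrite oppr_eq0 => /eqP g0; apply: nz.
  by rewrite -zr -zi -gr -gi z0 g0 !r0 !i0.
apply/eqE; rewrite opprK; split; apply: ReIm_mx_inj.
- by rewrite Re_mxD !Re_map_mulmx Re_scalemx zr zi gr.
- by rewrite Im_mxD !Im_map_mulmx Im_scalemx zr zi gi.
- by rewrite Re_mxD !Re_map_mulmx zr gr hx' r0.
- by rewrite Im_mxD !Im_map_mulmx zi gi hy' i0.
Qed.

(** Each weighted energy is the squared norm of the corresponding block, because [W i] is the square
    of its symmetric root; the nonzero scaling [c] cancels. *)
Lemma stacked_output_eq0 (R : realType) (N n m : nat) (p : 'I_N -> nat)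
    (A : 'M[R]_n) (B : 'M[R]_(n, m))
    (C : forall i, 'M[R]_(p i, n)) (D : forall i, 'M[R]_(p i, m))
    (S : {set 'I_N}) (W : forall i, 'M[R]_(p i)) (c : R)
    (x : 'cV[R]_n) (u : 'cV[R]_m) :
  c != 0 -> (forall i, i \in S -> psdmx (W i)) ->
  let Sg := stacked_sys A B C D S W c in
  ssC Sg *m x + ssD Sg *m u = 0 <->
  forall i, i \in S -> qform (W i) (C i *m x + D i *m u) = 0.
Proof.
move=> c0 Wpsd /=.
rewrite -!scalemxAl -scalerDr !mxcol_mul -mxcolD; split.
  move=> /eqP; rewrite scaler_eq0 (negbTE c0) /= => /eqP.
  rewrite -[RHS](@mxcol0 _ _ (fun k => p (enum_val k))) => /eq_mxcolP h i iS.
  (* [enum_rank_in iS i] is the position of the block that belongs to [i]. *)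
  have := h (enum_rank_in iS i); rewrite enum_rankK_in// => h'.
  by rewrite (qform_sqrtmx _ (Wpsd _ iS)) mulmxDr !mulmxA h' mulmx0 mxE.
move=> h; rewrite -[X in _ *: X = _]/(\mxcol_k _).
rewrite (_ : \mxcol_k _ = 0) ?scaler0//.
rewrite -[RHS](@mxcol0 _ _ (fun k => p (enum_val k))); apply: eq_mxcol => k.
have kS := enum_valP k.
rewrite -!mulmxA -mulmxDr; apply: sqnorm_eq0.
by rewrite -(qform_sqrtmx _ (Wpsd _ kS)) h.
Qed.

(** * The pointwise dissipation inequality, and infeasibility caused by an unstable zero *)

Lemma qformD (R : realType) k (P Q : 'M[R]_k) v :
  qform (P + Q) v = qform P v + qform Q v.
Proof. by rewrite /qform mulmxDr mulmxDl mxE. Qed.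

Lemma qformN (R : realType) k (P : 'M[R]_k) v : qform (- P) v = - qform P v.
Proof. by rewrite /qform mulmxN mulNmx mxE. Qed.

Lemma qformZ (R : realType) k a (P : 'M[R]_k) v : qform (a *: P) v = a * qform P v.
Proof. by rewrite /qform -scalemxAr -scalemxAl mxE. Qed.

Lemma qform_sum (R : realType) k (I : finType) (S : {pred I}) (P : I -> 'M[R]_k) v :
  qform (\sum_(i in S) P i) v = \sum_(i in S) qform (P i) v.
Proof. by rewrite /qform mulmx_sumr mulmx_suml summxE. Qed.

Lemma qform_output (R : realType) n m q (C : 'M[R]_(q, n)) (D : 'M[R]_(q, m))
    (W : 'M[R]_q) x u :
  qform (col_mx C^T D^T *m W *m row_mx C D) (col_mx x u) =
  qform W (C *m x + D *m u).
Proof.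
rewrite /qform -mul_row_col trmx_mul tr_row_mx !mulmxA.
by rewrite !tr_col_mx.
Qed.

(** With [A *m x + B *m u] read as the derivative of [x], the right-hand side is the product rule
    for the storage function [qform P x]. *)
Lemma qform_storage_rate (R : realType) n m (A P : 'M[R]_n) (B : 'M[R]_(n, m)) x u :
  qform (block_mx (A^T *m P + P *m A) (P *m B) (B^T *m P) 0) (col_mx x u) =
  (x^T *m P *m (A *m x + B *m u)) 0 0 + ((A *m x + B *m u)^T *m P *m x) 0 0.
Proof.
rewrite /qform -mulmxA mul_block_col mul0mx addr0 tr_col_mx mul_row_col.
have D00 (X Y : 'M[R]_1) : (X + Y) 0 0 = X 0 0 + Y 0 0 by rewrite mxE.
have -> : (A *m x + B *m u)^T = x^T *m A^T + u^T *m B^T.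
  by rewrite linearD /= !trmx_mul.
rewrite !(mulmxDl, mulmxDr) !mulmxA !D00.
ring.
Qed.

(** Stated for arbitrary vectors rather than along a trajectory, so that it serves both the signals
    of (OP) and the real and imaginary parts of a zero direction. *)
Lemma SDP_dissipation (R : realType) (N n m : nat) (p : 'I_N -> nat)
    (A : 'M[R]_n) (B : 'M[R]_(n, m))
    (C : forall i, 'M[R]_(p i, n)) (D : forall i, 'M[R]_(p i, m))
    (Pset Mset : {set 'I_N}) (Q Rw : forall i, 'M[R]_(p i))
    (gam : 'cV[R]_#|Mset|) (P : 'M[R]_n) (x : 'cV[R]_n) (u : 'cV[R]_m) :
  SDP_feasible A B C D Pset Q Rw gam P ->
  (x^T *m P *m (A *m x + B *m u)) 0 0 + ((A *m x + B *m u)^T *m P *m x) 0 0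
    + #|Pset|%:R^-1 * \sum_(i in Pset) qform (Q i) (C i *m x + D i *m u)
  <= \sum_(k < #|Mset|) gam k 0 * qform (Rw (enum_val k))
       (C (enum_val k) *m x + D (enum_val k) *m u).
Proof.
case=> _ _ [_ /(_ (col_mx x u))].
rewrite qformN oppr_ge0 qformD qform_storage_rate /Gamma qformD qformZ qformN.
rewrite !qform_sum addrA subr_le0.
under eq_bigr do rewrite qform_output.
by under [leRHS]eq_bigr do rewrite qformZ qform_output.
Qed.

Lemma SDP_infeasible (R : realType) (N n m : nat) (p : 'I_N -> nat)
    (A : 'M[R]_n) (B : 'M[R]_(n, m))
    (C : forall i, 'M[R]_(p i, n)) (D : forall i, 'M[R]_(p i, m))
    (Pset Mset : {set 'I_N}) (Q Rw : forall i, 'M[R]_(p i)) (b : R[i])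
    (gam : 'cV[R]_#|Mset|) (P : 'M[R]_n) :
  Pset != finset.set0 ->
  (forall i, i \in Pset -> psdmx (Q i)) ->
  (forall j, j \in Mset -> psdmx (Rw j)) ->
  unstable b -> is_zero (Sigma_m A B C D Mset Rw) b ->
  ~ is_zero (Sigma_p A B C D Pset Q) b ->
  ~ SDP_feasible A B C D Pset Q Rw gam P.
Proof.
move=> P0 hQ hR; rewrite /unstable => b0.
move=> /is_zeroP[x [y [v [w [nz hx hy hx' hy']]]]] nzp feas.
apply: nzp; apply/is_zeroP; exists x, y, v, w.
have cardP : 0 < #|Pset|%:R :> R by rewrite ltr0n card_gt0.
have c0 : (Num.sqrt #|Pset|%:R)^-1 != 0 :> R.
  by rewrite invr_eq0 gt_eqF// sqrtr_gt0.
move: hx' => /(stacked_output_eq0 A B C D x v (oner_neq0 R) hR) hx'.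
move: hy' => /(stacked_output_eq0 A B C D y w (oner_neq0 R) hR) hy'.
rewrite /= in hx hy.
have := lerD (SDP_dissipation x v feas) (SDP_dissipation y w feas).
rewrite [leRHS](_ : _ = 0); last first.
  rewrite !big1 ?addr0// => k _; rewrite ?hx' ?hy' ?mulr0//; exact: enum_valP.
rewrite hx hy.
set sx := \sum_(i in Pset) _; set sy := \sum_(i in Pset) _ => le0.
have sx0 : 0 <= sx by apply: sumr_ge0 => i /hQ[_]; exact.
have sy0 : 0 <= sy by apply: sumr_ge0 => i /hQ[_]; exact.
have Ppsd : psdmx P by case: feas.
have Px := proj2 Ppsd x; have Py := proj2 Ppsd y.
have D00 (X Y : 'M[R]_1) : (X + Y) 0 0 = X 0 0 + Y 0 0 by rewrite mxE.
have N00 (X : 'M[R]_1) : (- X) 0 0 = - X 0 0 by rewrite mxE.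
have Z00 a (X : 'M[R]_1) : (a *: X) 0 0 = a * X 0 0 by rewrite mxE.
(* In the sum of the two inequalities the cross terms carrying [complex.Im b] cancel, and only the
   part with [complex.Re b] is left. *)
have {}le0 : complex.Re b * 2 * (qform P x + qform P y) +
    #|Pset|%:R^-1 * (sx + sy) <= 0.
  apply: le_trans le0; rewrite le_eqVlt; apply/orP; left; apply/eqP.
  rewrite !linearD /= !linearN /= !linearZ /= -?scalemxAl -?scalemxAr.
  rewrite !(mulmxDl, mulmxDr, mulNmx, mulmxN) -?scalemxAl -?scalemxAr.
  rewrite !(mulNmx, D00, N00, Z00) -/(qform P x) -/(qform P y).
  ring.
(* The storage part is nonnegative since [complex.Re b] is positive and [P] is positive
   semidefinite, so the output part must be nonpositive; being a sum of nonnegative terms, it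
   vanishes term by term. *)
have {}le0 : sx + sy <= 0.
  rewrite -(pmulr_rle0 _ (x := #|Pset|%:R^-1)) ?invr_gt0//.
  by apply: le_trans le0; rewrite lerDr mulr_ge0 ?mulr_ge0 ?addr_ge0// ltW.
have sx00 : sx = 0 by apply/eqP; rewrite eq_le sx0 andbT (le_trans _ le0)// lerDl.
have sy00 : sy = 0 by apply/eqP; rewrite eq_le sy0 andbT (le_trans _ le0)// lerDr.
split=> //.
- apply/(stacked_output_eq0 A B C D x v c0 hQ) => i iP.
  by apply: (psumr_eq0P _ sx00) => // j /hQ[_]; exact.
- apply/(stacked_output_eq0 A B C D y w c0 hQ) => i iP.
  by apply: (psumr_eq0P _ sy00) => // j /hQ[_]; exact.
Qed.

(** * Integration by parts for primitives of integrable functions *)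

Local Open Scope classical_set_scope.
Local Open Scope ring_scope.

Lemma EFin_Rintegral d (T : measurableType d) (R : realType)
    (mu : {measure set T -> \bar R}) (D : set T) (f : T -> R) :
  measurable D -> mu.-integrable D (EFin \o f) ->
  (\int[mu]_(x in D) f x)%:E = (\int[mu]_(x in D) (f x)%:E)%E.
Proof. by move=> mD fi; rewrite fineK//; exact: integrable_fin_num. Qed.

(* Fubini for [f s * g t] on the half-plane [s <= t]. *)
Lemma Rintegral_mul_primitive (R : realType) (f g : R -> R) :
  let mu := @lebesgue_measure R in
  let F t := \int[mu]_(s in `]-oo, t]) f s in
  let G t := \int[mu]_(s in `]-oo, t]) g s in
  mu.-integrable setT (EFin \o f) -> mu.-integrable setT (EFin \o g) ->
  mu.-integrable setT (EFin \o (fun t => f t * G t)) /\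
  \int[mu]_t (g t * F t) =
    (\int[mu]_t f t) * (\int[mu]_t g t) - \int[mu]_t (f t * G t).
Proof.
move=> mu F G fi gi.
have mf : measurable_fun setT f by apply/measurable_EFinP; exact: measurable_int fi.
have mg : measurable_fun setT g by apply/measurable_EFinP; exact: measurable_int gi.
pose E : set (R * R) := [set z | z.1 <= z.2].
have mE : measurable E.
  have := @measurable_fun_ler _ _ R setT fst snd measurable_fst measurable_snd.
  by move=> /(_ measurableT [set true] I); rewrite setTI.
pose h z : R := f z.1 * g z.2 * \1_E z.
have mfg : measurable_fun setT (fun z : R * R => f z.1 * g z.2).
  by apply: measurable_funM; apply: measurableT_comp.
have mh : measurable_fun setT h.
  by apply: measurable_funM => //; exact: measurable_indic.
(* By Tonelli: the iterated integral of the absolute value is that of [|f s|] times the finite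
   constant [K]. The truncated product [h] is then dominated by this one. *)
have fgi : (mu \x mu)%E.-integrable setT (EFin \o (fun z => f z.1 * g z.2)).
  apply/integrable12ltyP; first exact/measurable_EFinP.
  pose K := \int[mu]_t `|g t|.
  have inner s : (\int[mu]_t `|(f s * g t)%:E| = (`|f s| * K)%:E)%E.
    rewrite EFinM EFin_Rintegral//; last exact: integrable_norm.
    rewrite -ge0_integralZl//; last first.
      by apply/measurable_EFinP; exact: measurableT_comp.
    by apply: eq_integral => t _; rewrite -EFinM -normrM.
  under eq_integral do rewrite inner EFinM.
  have fKi : mu.-integrable setT (fun s => `|f s|%:E * K%:E)%E.
    by apply: integrableZr => //; exact: integrable_norm.
  have := integrable_fin_num measurableT fKi; rewrite fin_num_abs.
  by apply: le_lt_trans; exact: lee_abs.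
have hi : (mu \x mu)%E.-integrable setT (EFin \o h).
  apply: (le_integrable _ _ _ fgi) => //; first exact/measurable_EFinP.
  move=> z _; rewrite /= lee_fin /h normrM ler_piMr// indicE.
  by case: (_ \in _); rewrite ?normr1 ?normr0.
have RyT : [set` Interval -oo%O +oo%O] = [set: R] by apply/seteqP; split => x.
have giI D : measurable D -> mu.-integrable D (EFin \o g).
  by move=> mD; apply: integrableS gi.
have fiI D : measurable D -> mu.-integrable D (EFin \o f).
  by move=> mD; apply: integrableS fi.
(* Integrating in [t] first leaves the tail of [g] over [[s, +oo[], written as the total integral
   minus [G s]; the endpoint [s] has measure zero. *)
have hF s : (\int[mu]_t (h (s, t))%:E = (f s * (\int[mu]_t g t - G s))%:E)%E.
  have -> : \int[mu]_t g t - G s = \int[mu]_(t in `[s, +oo[) g t.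
    rewrite -RyT /G Rintegral_itvB//; last by rewrite RyT.
    by rewrite Rintegral_itv_obnd_cbnd//; exact: giI.
  rewrite EFinM EFin_Rintegral//; last exact: giI.
  rewrite -integralZl//; last exact: giI.
  rewrite [RHS]integral_mkcond; apply: eq_integral => t _.
  rewrite /h /= patchE indicE.
  have -> : ((s, t) \in E) = (t \in `[s, +oo[%classic).
    by apply/idP/idP; rewrite !inE /E /= in_itv /= andbT.
  by case: ifP => _; rewrite ?mulr1 ?mulr0.
have hG t : (\int[mu]_s (h (s, t))%:E = (g t * F t)%:E)%E.
  rewrite mulrC EFinM EFin_Rintegral//; last exact: fiI.
  rewrite -integralZr//; last exact: fiI.
  rewrite [RHS]integral_mkcond; apply: eq_integral => s _.
  rewrite /h /= patchE indicE.
  have -> : ((s, t) \in E) = (s \in `]-oo, t]%classic).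
    by apply/idP/idP; rewrite !inE.
  by case: ifP => _; rewrite ?mulr1 ?mulr0.
have iF : mu.-integrable setT (EFin \o (fun s => f s * (\int[mu]_t g t - G s))).
  have := integrable_fubini_F hi; rewrite /fubini_F /=.
  by under eq_fun do rewrite hF.
have fKi : mu.-integrable setT (EFin \o (fun s => f s * \int[mu]_t g t)).
  by apply: (integrableZr measurableT (\int[mu]_t g t) fi).
(* Integrability of [f * G] comes from writing it as the difference of two functions already known
   to be integrable. *)
have fGi : mu.-integrable setT (EFin \o (fun s => f s * G s)).
  apply: (eq_integrable measurableT _ _ _ (integrableB measurableT fKi iF)).
  by move=> s _ /=; rewrite -EFinB; congr EFin; ring.
split=> //.
have := Fubini hi => /=.
under eq_integral do rewrite hF.
under [X in _ = X -> _]eq_integral do rewrite hG.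
move=> /(congr1 fine).
rewrite -[fine _]/(\int[mu]_s (f s * (\int[mu]_t g t - G s))).
rewrite -[X in _ = X -> _]/(\int[mu]_t (g t * F t)) => <-.
under eq_Rintegral do rewrite mulrBr.
by rewrite RintegralB// RintegralZr.
Qed.

(** Cutting [f] off outside [[0, T]] turns its primitive from 0 into a primitive from minus
    infinity, the form to which the whole-line Fubini identity applies. *)
Lemma primitive_restrict (R : realType) (f : R -> R) (T t : R) :
  let mu := @lebesgue_measure R in t <= T ->
  \int[mu]_(s in `]-oo, t]) (f \_ `[0, T]) s = \int[mu]_(s in `[0, t]) f s.
Proof.
move=> mu tT; rewrite -Rintegral_mkcondr; congr (Rintegral _ _ _).
apply/seteqP; split => s /=; rewrite !in_itv /=.
  by move=> [-> /andP[->]].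
by move=> /andP[-> st]; split => //; rewrite (le_trans st).
Qed.

(** The whole-line identity applied to the cut-offs of [f] and [g]. It replaces the classical
    product rule when [f] and [g] are merely integrable, so that their primitives need not be
    differentiable everywhere. *)
Lemma integration_by_parts_primitives (R : realType) (f g : R -> R) (T : R) :
  let mu := @lebesgue_measure R in
  let F t := \int[mu]_(s in `[0, t]) f s in
  let G t := \int[mu]_(s in `[0, t]) g s in
  mu.-integrable `[0, T] (EFin \o f) -> mu.-integrable `[0, T] (EFin \o g) ->
  [/\ mu.-integrable `[0, T] (EFin \o (fun t => g t * F t)),
      mu.-integrable `[0, T] (EFin \o (fun t => f t * G t)) &
      \int[mu]_(t in `[0, T]) (g t * F t) + \int[mu]_(t in `[0, T]) (f t * G t) =
      F T * G T].
Proof.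
move=> mu F G fi gi.
have ext (k : R -> R) : mu.-integrable `[0, T] (EFin \o k) <->
    mu.-integrable setT (EFin \o (fun t => (k \_ `[0, T]) t)).
  have := @integrable_mkcond _ _ R mu _ (EFin \o k) (measurable_itv `[0, T]).
  by rewrite restrict_EFin.
have prodE (k l : R -> R) t :
    (k \_ `[0, T]) t * \int[mu]_(s in `]-oo, t]) (l \_ `[0, T]) s =
    ((fun t => k t * \int[mu]_(s in `[0, t]) l s) \_ `[0, T]) t.
  rewrite !patchE; case: ifPn; last by rewrite mul0r.
  by rewrite inE /= in_itv /= => /andP[_ tT]; rewrite primitive_restrict.
have fTi := (ext _).1 fi; have gTi := (ext _).1 gi.
have [fGi] := Rintegral_mul_primitive fTi gTi.
(* The roles of [f] and [g] are exchanged only to get integrability of the other product. *)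
have [gFi _] := Rintegral_mul_primitive gTi fTi.
under eq_Rintegral do rewrite prodE.
under [X in _ = _ - X -> _]eq_Rintegral do rewrite prodE.
rewrite -!Rintegral_mkcond => ->; rewrite subrK; split => //; apply/ext.
  by move: gFi; under eq_fun do rewrite prodE.
by move: fGi; under eq_fun do rewrite prodE.
Qed.

(** * Linear combinations of integrals, and passage to the half-line *)

Section has_Rintegral.
Context d (T : measurableType d) (R : realType) (mu : {measure set T -> \bar R}).
Variables (D : set T) (mD : measurable D).

(** Integrability and value travel together, so a finite linear combination can be integrated
    without a separate integrability argument for each partial sum. *)
Definition has_Rintegral (f : T -> R) (v : R) : Prop :=
  mu.-integrable D (EFin \o f) /\ \int[mu]_(x in D) f x = v.

Lemma has_RintegralD f g a b : has_Rintegral f a -> has_Rintegral g b ->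
  has_Rintegral (fun x => f x + g x) (a + b).
Proof.
move=> [fi <-] [gi <-]; split; last exact: RintegralD.
exact: (integrableD mD fi gi).
Qed.

Lemma has_RintegralZ c f a : has_Rintegral f a ->
  has_Rintegral (fun x => c * f x) (c * a).
Proof.
move=> [fi <-]; split; last exact: RintegralZl.
exact: (integrableZl mD c fi).
Qed.

Lemma has_Rintegral_sum (I : finType) (f : I -> T -> R) (v : I -> R) :
  (forall i, has_Rintegral (f i) (v i)) ->
  has_Rintegral (fun x => \sum_i f i x) (\sum_i v i).
Proof.
move=> h.
have -> : (fun x => \sum_i f i x) = \sum_i f i.
  by apply/funext => x; rewrite fct_sumE.
apply: big_ind2 => //.
- split; first exact: integrable0.
  by rewrite /Rintegral integral0.
- by move=> f1 v1 f2 v2; exact: has_RintegralD.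
Qed.

Lemma eq_has_Rintegral f g v : {in D, f =1 g} ->
  has_Rintegral f v -> has_Rintegral g v.
Proof.
move=> fg [fi <-]; split; last by apply/esym; exact: eq_Rintegral.
by apply: (eq_integrable mD _ _ _ fi) => t tD /=; rewrite fg.
Qed.

End has_Rintegral.

(** Monotone convergence along the increasing intervals [[0, k]], whose union is the half-line. *)
Lemma ge0_integral_halfline_le (R : realType) (f : R -> \bar R) (c : \bar R) :
  measurable_fun (`[0, +oo[ : set R) f -> (forall t, (0 <= f t)%E) ->
  (forall T, 0 <= T -> (\int[lebesgue_measure]_(t in `[0%R, T]) f t <= c)%E) ->
  (\int[lebesgue_measure]_(t in `[0%R, +oo[) f t <= c)%E.
Proof.
move=> mf f0 fc.
rewrite itv_bndy_bigcup_BRight.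
pose F (k : nat) : set R := `[0, 0 + k%:R]%classic.
have subF k : F k `<=` `[0, +oo[%classic.
  by move=> t /=; rewrite /F /= !in_itv /= andbT => /andP[].
have : (\int[lebesgue_measure]_(t in F k) f t @[k --> \oo] -->
    \int[lebesgue_measure]_(t in \bigcup_k F k) f t)%E.
  apply: ge0_nondecreasing_set_cvg_integral => //.
  - move=> k l kl; apply/subsetPset => t; rewrite /F /= !in_itv /= !add0r.
    by move=> /andP[-> /le_trans]; apply; rewrite ler_nat.
  - by move=> k; exact: measurable_itv.
  - by move=> k; exact: measurable_funS (subF k) mf.
move=> cvgF; apply: (cvge_to_le cvgF); apply: nearW => k.
by rewrite /F add0r; exact: fc.
Qed.

(** * Integrability of the signals and the energy balance along a trajectory *)

Lemma bilinearE (R : realType) n (P : 'M[R]_n) (v w : 'cV[R]_n) :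
  (v^T *m P *m w) 0 0 = \sum_i \sum_j P i j * (v i 0 * w j 0).
Proof.
rewrite mxE exchange_big; apply: eq_bigr => j _ /=.
rewrite mxE big_distrl /=; apply: eq_bigr => i _; rewrite !mxE; ring.
Qed.

Section energy_balance.
Context (R : realType) (n m : nat) (A : 'M[R]_n) (B : 'M[R]_(n, m)).
Local Notation mu := (@lebesgue_measure R).
Variables (u : R -> 'cV[R]_m) (x : R -> 'cV[R]_n).
Hypothesis uL2 : L2e u.

(** On a bounded interval the constant 1 is integrable, and [|a| <= 1 + a ^+ 2] bounds each entry of
    [u] by an integrable function. *)
Lemma L2e_integrable T i : 0 <= T ->
  mu.-integrable `[0, T] (EFin \o (fun t => u t i 0)).
Proof.
have [mu_ fin] := uL2 => T0.
have sub : (`[0, T] : set R) `<=` `[0, +oo[.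
  by move=> t /=; rewrite !in_itv /= andbT => /andP[].
have muT k : measurable_fun (`[0, T] : set R) (fun t => u t k 0).
  by apply: measurable_funS (mu_ k).
have uu0 t : 0 <= ((u t)^T *m u t) 0 0 := sqnorm_ge0 _.
have uuE : (fun t => ((u t)^T *m u t) 0 0) = (fun t => \sum_k u t k 0 ^+ 2).
  by apply/funext => t; rewrite sqnormE.
have uui : mu.-integrable `[0, T] (EFin \o (fun t => ((u t)^T *m u t) 0 0)).
  apply/integrableP; split.
    apply/measurable_EFinP; rewrite uuE; apply: measurable_sum => k.
    by apply: measurable_funX; exact: muT.
  by under eq_integral do rewrite /= ger0_norm//; exact: fin.
have oi : mu.-integrable `[0, T] (EFin \o (fun=> 1)).
  apply: measurable_bounded_integrable => //.
  - exact: compact_finite_measure (@segment_compact R 0 T).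
  - by exists 1; split=> // y y1 t _ /=; rewrite normr1 ltW.
have := @integrableD _ _ _ mu _ (measurable_itv `[0, T]) _ _ oi uui.
apply: le_integrable => //; first by apply/measurable_EFinP; exact: muT.
move=> t _ /=; rewrite lee_fin [leRHS]ger0_norm ?addr_ge0//.
rewrite sqnormE (bigD1 i)//= addrA (@le_trans _ _ (1 + u t i 0 ^+ 2))//; last first.
  by rewrite lerDl sumr_ge0// => k _; exact: sqr_ge0.
rewrite -real_normK ?num_real//; move: (normr_ge0 (u t i 0)); nra.
Qed.

Hypothesis xu : trajectory A B 0 u x.

Lemma trajectory_integrable T i : 0 <= T ->
  mu.-integrable `[0, T] (EFin \o (fun t => x t i 0)).
Proof.
have [cx _] := xu => T0.
apply: continuous_compact_integrable; first exact: segment_compact.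
apply: continuous_subspaceW (cx i) => t /=.
by rewrite !in_itv /= andbT => /andP[].
Qed.

Lemma mulmx_integrable k l (X : 'M[R]_(k, l)) (v : R -> 'cV[R]_l) T i :
  (forall j, mu.-integrable `[0, T] (EFin \o (fun t => v t j 0))) ->
  mu.-integrable `[0, T] (EFin \o (fun t => (X *m v t) i 0)).
Proof.
move=> vi.
have Xvi j : has_Rintegral mu `[0, T] (fun t => X i j * v t j 0)
    (X i j * \int[mu]_(t in `[0, T]) v t j 0).
  by apply: has_RintegralZ => //; split=> //; exact: vi.
have [+ _] := @has_Rintegral_sum _ _ R mu _ (measurable_itv `[0, T]) _ _ _ Xvi.
by congr (_.-integrable _ (_ \o _)); apply/funext => t; rewrite mxE.
Qed.

Lemma vector_field_integrable T i : 0 <= T ->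
  mu.-integrable `[0, T] (EFin \o (fun t => (A *m x t + B *m u t) i 0)).
Proof.
move=> T0.
have -> : (fun t => (A *m x t + B *m u t) i 0) =
    (fun t => (A *m x t) i 0 + (B *m u t) i 0).
  by apply/funext => t; rewrite mxE.
have Axi := mulmx_integrable A i (fun j => trajectory_integrable j T0).
have Bui := mulmx_integrable B i (fun j => L2e_integrable j T0).
exact: (@integrableD _ _ R mu _ (measurable_itv `[0, T]) _ _ Axi Bui).
Qed.

Lemma trajectoryE t i : 0 <= t ->
  x t i 0 = \int[mu]_(s in `[0, t]) (A *m x s + B *m u s) i 0.
Proof. by move=> t0; have [_ /(_ t i t0) ->] := xu; rewrite mxE add0r. Qed.

(** In coordinates the storage function is a combination of products of state entries. Each entry is
    the primitive of the matching entry of the vector field, so integration by parts applies to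
    every pair; the start at the origin leaves only the boundary term at [T]. *)
Lemma storage_balance (P : 'M[R]_n) T : 0 <= T ->
  has_Rintegral mu `[0, T] (fun t =>
    ((x t)^T *m P *m (A *m x t + B *m u t)) 0 0 +
    ((A *m x t + B *m u t)^T *m P *m x t) 0 0) (qform P (x T)).
Proof.
move=> T0; rewrite /qform bilinearE.
pose f i t := (A *m x t + B *m u t) i 0.
have -> : (fun t => ((x t)^T *m P *m (A *m x t + B *m u t)) 0 0 +
    ((A *m x t + B *m u t)^T *m P *m x t) 0 0) =
    (fun t => \sum_i \sum_j P i j * (f j t * x t i 0 + f i t * x t j 0)).
  apply/funext => t; rewrite !bilinearE -big_split; apply: eq_bigr => i _.
  rewrite -big_split; apply: eq_bigr => j _ /=; rewrite /f; ring.
apply: has_Rintegral_sum => // i; apply: has_Rintegral_sum => // j.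
apply: has_RintegralZ => //.
have [fXj fXi] := integration_by_parts_primitives
  (vector_field_integrable i T0) (vector_field_integrable j T0).
rewrite -!trajectoryE// => <-.
(* The primitive [X i] agrees with the state entry only for nonnegative times, so the integrands are
   identified on [[0, T]] alone. *)
pose X i t := \int[mu]_(s in `[0, t]) f i s.
apply: (@eq_has_Rintegral _ _ R mu _ (measurable_itv `[0, T])
  (fun t => f j t * X i t + f i t * X j t)).
  by move=> t; rewrite inE /= in_itv /= => /andP[t0 _]; rewrite !trajectoryE.
by apply: has_RintegralD => //; split.
Qed.

Lemma output_measurable q (C : 'M[R]_(q, n)) (D : 'M[R]_(q, m)) k :
  measurable_fun (`[0, +oo[ : set R) (fun t => output C D u x t k 0).
Proof.
have [cx _] := xu; have [mu_ _] := uL2.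
have -> : (fun t => output C D u x t k 0) = (fun t =>
    \sum_j C k j * x t j 0 + \sum_j D k j * u t j 0).
  by apply/funext => t; rewrite /output !mxE.
apply: measurable_funD; apply: measurable_sum => j; apply: measurable_funM => //.
exact: subspace_continuous_measurable_fun (cx j).
Qed.

Lemma qform_output_measurable q (C : 'M[R]_(q, n)) (D : 'M[R]_(q, m)) (W : 'M[R]_q) :
  measurable_fun (`[0, +oo[ : set R) (fun t => qform W (output C D u x t)).
Proof.
have -> : (fun t => qform W (output C D u x t)) = (fun t =>
    \sum_i \sum_j W i j * (output C D u x t i 0 * output C D u x t j 0)).
  by apply/funext => t; exact: bilinearE.
apply: measurable_sum => i; apply: measurable_sum => j.
by apply: measurable_funM => //; apply: measurable_funM; exact: output_measurable.
Qed.

(** Turns an extended-real constraint of (OP) into a real integral: a nonnegative measurable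
    integrand with finite energy is integrable. *)
Lemma has_Rintegral_energy q (C : 'M[R]_(q, n)) (D : 'M[R]_(q, m)) (W : 'M[R]_q) d :
  psdmx W -> (energy W (output C D u x) <= d%:E)%E ->
  exists2 e, e <= d &
    has_Rintegral mu `[0, +oo[ (fun t => qform W (output C D u x t)) e.
Proof.
move=> [_ W0] Ed.
have E0 : (0 <= energy W (output C D u x))%E.
  by apply: integral_ge0 => t _; rewrite lee_fin.
have Efin : energy W (output C D u x) \is a fin_num.
  by rewrite ge0_fin_numE// (le_lt_trans Ed)// ltry.
exists (fine (energy W (output C D u x))).
  by rewrite -lee_fin fineK.
split=> //; apply/integrableP; split.
  by apply/measurable_EFinP; exact: qform_output_measurable.
under eq_integral do rewrite /= ger0_norm//.
by rewrite (le_lt_trans Ed)// ltry.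
Qed.

End energy_balance.

(** * Weak duality, and the two claims *)

(** The dissipation inequality is integrated over finite horizons [[0, T]], where the storage rate
    is integrable. The resulting bound is independent of [T], so it passes to the half-line, and
    finiteness of the objective is a consequence rather than an assumption. *)
Lemma weak_duality (R : realType) (N n m : nat) (p : 'I_N -> nat)
    (A : 'M[R]_n) (B : 'M[R]_(n, m))
    (C : forall i, 'M[R]_(p i, n)) (D : forall i, 'M[R]_(p i, m))
    (Pset Mset : {set 'I_N}) (Q Rw : forall i, 'M[R]_(p i)) (delta : 'I_N -> R)
    (u : R -> 'cV[R]_m) (x : R -> 'cV[R]_n) (gam : 'cV[R]_#|Mset|) (P : 'M[R]_n) :
  (forall i, i \in Pset -> psdmx (Q i)) ->
  (forall j, j \in Mset -> psdmx (Rw j)) ->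
  L2e u -> trajectory A B 0 u x ->
  (forall j, j \in Mset ->
    (energy (Rw j) (output (C j) (D j) u x) <= (delta j)%:E)%E) ->
  SDP_feasible A B C D Pset Q Rw gam P ->
  ((#|Pset|%:R^-1)%:E *
     \sum_(i in Pset) energy (Q i) (output (C i) (D i) u x) <=
   (\sum_(k < #|Mset|) gam k 0 * delta (enum_val k))%:E)%E.
Proof.
move=> hQ hR uL2 xu hE feas.
have [gam0 [_ P0] _] := feas.
pose mu := @lebesgue_measure R.
pose y i t := output (C i) (D i) u x t.
(* [phi] is the integrand of the objective, [psi] the multiplier-weighted integrand of the
   constraints, and [w] the storage rate. *)
pose phi t := #|Pset|%:R^-1 *
  \sum_(k < #|Pset|) qform (Q (enum_val k)) (y (enum_val k) t).
pose psi t := \sum_(k < #|Mset|) gam k 0 * qform (Rw (enum_val k)) (y (enum_val k) t).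
pose w t := ((x t)^T *m P *m (A *m x t + B *m u t)) 0 0 +
  ((A *m x t + B *m u t)^T *m P *m x t) 0 0.
have phi0 t : 0 <= phi t.
  rewrite /phi mulr_ge0 ?invr_ge0//; apply: sumr_ge0 => k _.
  by have [_] := hQ _ (enum_valP k); exact.
have psi0 t : 0 <= psi t.
  apply: sumr_ge0 => k _; rewrite mulr_ge0//.
  by have [_] := hR _ (enum_valP k); exact.
have phipsi t : phi t <= psi t - w t.
  rewrite lerBrDl; apply: le_trans (SDP_dissipation (x t) (u t) feas).
  by rewrite big_enum_val; exact: lexx.
have mQ i : measurable_fun (`[0, +oo[ : set R) (fun t => qform (Q i) (y i t)).
  exact: (qform_output_measurable uL2 xu (C i) (D i) (Q i)).
have mphi : measurable_fun (`[0, +oo[ : set R) phi.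
  apply: measurable_funM => //; apply: measurable_sum => k.
  exact: mQ.
have mitvy : measurable (`[0, +oo[ : set R) by exact: measurable_itv.
have [v vle [psii psiv]] : exists2 v, v <= \sum_(k < #|Mset|) gam k 0 * delta (enum_val k) &
    has_Rintegral mu `[0, +oo[ psi v.
  (* [e k] is the energy actually spent in constraint [k]; nonnegative multipliers carry
     [e k <= delta] over to the weighted sums. *)
  have /choice[e he] : forall k : 'I_#|Mset|, exists e, e <= delta (enum_val k) /\
      has_Rintegral mu `[0, +oo[
        (fun t => qform (Rw (enum_val k)) (y (enum_val k) t)) e.
    move=> k; have kM := enum_valP k.
    by have [e] := has_Rintegral_energy uL2 xu (hR _ kM) (hE _ kM); exists e.
  exists (\sum_k gam k 0 * e k).
    by apply: ler_sum => k _; rewrite ler_wpM2l//; case: (he k).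
  apply: has_Rintegral_sum => // k; apply: has_RintegralZ => //.
  by case: (he k).
have -> : ((#|Pset|%:R^-1)%:E *
     \sum_(i in Pset) energy (Q i) (output (C i) (D i) u x))%E =
    (\int[mu]_(t in `[0%R, +oo[) (phi t)%:E)%E.
  rewrite big_enum_val /energy -ge0_integral_sum//; last 2 first.
  - by move=> k; apply/measurable_EFinP; exact: mQ.
  - by move=> k t _; rewrite lee_fin; have [_] := hQ _ (enum_valP k); exact.
  rewrite -ge0_integralZl//.
  - by apply: eq_integral => t _; rewrite sumEFin -EFinM.
  - by apply: emeasurable_sum => k; apply/measurable_EFinP; exact: mQ.
  - move=> t _; apply: sume_ge0 => k _; rewrite lee_fin.
    by have [_] := hQ _ (enum_valP k); exact.
apply: ge0_integral_halfline_le.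
- exact/measurable_EFinP.
- by move=> t; rewrite lee_fin.
move=> T T0.
have sub : (`[0, T] : set R) `<=` `[0, +oo[.
  by move=> t /=; rewrite !in_itv /= andbT => /andP[].
have [wi wv] := storage_balance uL2 xu P T0.
have psiTi : mu.-integrable `[0, T] (EFin \o psi).
  by apply: integrableS psii.
have psiwi : mu.-integrable `[0, T] (EFin \o (fun t => psi t - w t)).
  exact: (@integrableB _ _ R mu _ (measurable_itv `[0, T]) _ _ psiTi wi).
(* On [[0, T]], [phi] is squeezed between 0 and the integrable function [psi - w]. *)
have phii : mu.-integrable `[0, T] (EFin \o phi).
  apply: (le_integrable _ _ _ psiwi) => //.
    by apply/measurable_EFinP; exact: measurable_funS sub mphi.
  by move=> t _; rewrite /= lee_fin !ger0_norm ?(le_trans (phi0 t)).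
rewrite -EFin_Rintegral// lee_fin.
(* The integral of [w] is the storage [qform P (x T)], which is nonnegative and is dropped; the
   integral of [psi] then grows when its domain is extended from [[0, T]] to the half-line. *)
apply: (@le_trans _ _ (\int[mu]_(t in `[0, T]) psi t)).
  apply: le_trans (_ : \int[mu]_(t in `[0, T]) (psi t - w t) <= _).
    by apply: le_Rintegral.
  by rewrite RintegralB// -/w wv gerBl.
apply: le_trans vle; rewrite -psiv -lee_fin !EFin_Rintegral//.
apply: ge0_subset_integral => //.
  by apply: measurable_int psii.
by move=> t _; rewrite lee_fin.
Qed.

Local Close Scope classical_set_scope.

Theorem theorem10 (R : realType) (N n m : nat) (hN : (2 <= N)%N)
    (Pset Mset : {set 'I_N})
    (hP : Pset != finset.set0) (hM : Mset != finset.set0)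
    (hdisj : [disjoint Pset & Mset])
    (hcover : Pset :|: Mset = finset.setT)
    (p : 'I_N -> nat) (A : 'M[R]_n) (B : 'M[R]_(n, m))
    (C : forall i, 'M[R]_(p i, n)) (D : forall i, 'M[R]_(p i, m))
    (hA : hurwitz A) (hAB : controllable A B)
    (Q Rw : forall i, 'M[R]_(p i)) (delta : 'I_N -> R)
    (hQ : forall i, i \in Pset -> psdmx (Q i))
    (hRw : forall j, j \in Mset -> psdmx (Rw j))
    (hdelta : forall j, j \in Mset -> 0 < delta j) :
  (OP_value A B C D Pset Mset Q Rw delta
     <= SDP_value A B C D Pset Mset Q Rw delta)%E
  /\
  ((exists b : R[i], [/\ unstable b,
       is_zero (Sigma_m A B C D Mset Rw) b &
       ~ is_zero (Sigma_p A B C D Pset Q) b]) ->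
   SDP_value A B C D Pset Mset Q Rw delta = +oo%E).
Proof.
split.
  (* Comparing the supremum with the infimum reduces to comparing each admissible objective with
     each feasible cost. *)
  apply: ge_ereal_sup => _ [u [x [uL2 xu hE ->]]].
  apply: le_ereal_inf_tmp => _ [gam [P [feas ->]]].
  exact: weak_duality feas.
(* The infimum is [+oo] because the set of costs is empty: any member would provide a feasible
   pair. *)
move=> [b [b0 zm nzp]]; apply/ereal_inf_pinfty => v [gam [P [feas _]]].
by case: (SDP_infeasible hP hQ hRw b0 zm nzp feas).
Qed.
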